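(* Let $\alpha\in(0,1)$ and let $((P_t,X_t))_{t\in\mathbb{N}}$ be a sequence of p-values $P_t\in(0,1)$ and contextual feature vectors $X_t\in\mathcal{X}\subseteq\mathbb{R}^d$ attached to hypotheses $(H_t)_{t\in\mathbb{N}}$. Consider any contextual generalized alpha-investing rule (at level $\alpha$, not necessarily monotone), with significance levels $\alpha_t$ and decisions $R_t=\mathbf{1}\{P_t\le\alpha_t\}$. If the null p-values are conditionally super-uniform, i.e. for every $t$ with $H_t=0$, $$\Pr\big[P_t\le\alpha_t\mid\sigma(\mathcal{F}^{t-1}\cup\mathcal{G}^t)\big]\le\alpha_t ,$$ then $$\sup_{T\in\mathbb{N}}\ \mathrm{mFDR}(T)\le\alpha .$$
   Context: Hypotheses: $H_t\in\{0,1\}$, with $H_t=0$ meaning null and $H_t=1$ alternative; the truth values are fixed and unknown; $\mathcal{H}^0=\{t:H_t=0\}$. Decisions: a testing rule produces significance levels $\alpha_t=\alpha_t(R_1,\dots,R_{t-1},X_1,\dots,X_t)\ge 0$ and decisions $R_t=\mathbf{1}\{P_t\le\alpha_t\}$. Let $\mathcal{F}^t=\sigma(R_1,\dots,R_t)$ and $\mathcal{G}^t=\sigma(X_1,\dots,X_t)$. Let $\rho_1=\min\{i\in\mathbb{N}:\sum_{t=1}^i R_t=1\}$ be the time of the first rejection ($\rho_1=\infty$ if there is none). Contextual generalized alpha-investing (contextual GAI) rule at level $\alpha$: it is given by a constant $w_0$ and nonnegative functions $\alpha_t,\phi_t,\psi_t$, measurable with respect to $\sigma(\mathcal{F}^{t-1}\cup\mathcal{G}^t)$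 for every $t\ge1$ (functions of $R_1,\dots,R_{t-1},X_1,\dots,X_t$), such that (i) initial wealth: $W(0)=w_0$ with $0<w_0<\alpha$; (ii) wealth update: $W(t)=W(t-1)-\phi_t+R_t\psi_t$; (iii) non-negativity: $\phi_t\le W(t-1)$; (iv) bound on reward: $\psi_t\le\min\{\phi_t+b_t,\ \phi_t/\alpha_t+b_t-1\}$, where $b_t=\alpha-w_0\mathbf{1}\{\rho_1>t-1\}$ (when $\alpha_t=0$ the quotient $\phi_t/\alpha_t$ is read as $+\infty$). Marginal FDR: with $R(T)=\sum_{t=1}^T R_t$ and $V(T)=\sum_{t\le T,\,t\in\mathcal{H}^0}R_t$, $\ \mathrm{mFDR}(T)=\dfrac{\mathbb{E}[V(T)]}{\mathbb{E}[R(T)]+1}$. *)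

(* Defs.v *)
From HB Require Import structures.
From mathcomp Require Export all_boot all_order all_algebra.
From mathcomp Require Export all_classical all_reals all_analysis.

Set Implicit Arguments.
Unset Strict Implicit.
Unset Printing Implicit Defensive.

Import Order.TTheory GRing.Theory Num.Theory.
Import numFieldNormedType.Exports.

Local Open Scope classical_set_scope.
Local Open Scope ring_scope.

(* Time is shifted by one throughout: the hypothesis tested at time t >= 1, and
   everything attached to it, is stored at index t - 1.  Quantities describing
   the state after t steps (wealth, F^t, G^t, counts) keep the index t. *)

Section Conditioning.
Context {d : measure_display} {Omega : measurableType d} {R : realType}.

Definition measurable_wrt (G : set (set Omega)) (f : Omega -> R) : Prop :=
  measurable_fun [set: g_sigma_algebraType G]
    (f : g_sigma_algebraType G -> R).

(* Z is a version of the conditional probability of A given <<s G >>. *)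
Record is_cond_prob (Pr : probability Omega R) (G : set (set Omega))
    (A : set Omega) (Z : Omega -> R) : Prop := IsCondProb {
  cond_prob_measurable : measurable_wrt G Z ;
  cond_prob_integrable : Pr.-integrable [set: Omega] (EFin \o Z) ;
  cond_prob_integral : forall B, <<s G >> B ->
    (\int[Pr]_(w in B) (Z w)%:E = Pr (A `&` B))%E }.

(* Pr[A | <<s G >>] <= f almost surely.  Versions exist and any two of them are
   almost surely equal, so the choice of version is immaterial. *)
Definition cond_prob_le (Pr : probability Omega R) (G : set (set Omega))
    (A : set Omega) (f : Omega -> R) : Prop :=
  exists2 Z, is_cond_prob Pr G A Z & {ae Pr, forall w, Z w <= f w}.

End Conditioning.

Section Testing.
Context {d dX : measure_display} {Omega : measurableType d}
  {X : measurableType dX} {R : realType}.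
Implicit Types (p lvl phi psi : nat -> Omega -> R) (x : nat -> Omega -> X)
  (rej : nat -> Omega -> bool).

Definition decision p lvl (t : nat) (w : Omega) : bool := p t w <= lvl t w.

Definition rejections rej (t : nat) (w : Omega) : nat :=
  (\sum_(i < t) rej i w)%N.

Definition false_rejections (H : nat -> bool) rej (t : nat) (w : Omega) : nat :=
  (\sum_(i < t | ~~ H i) rej i w)%N.

Definition sigmaF rej (t : nat) : set (set Omega) :=
  g_sigma_preimage (fun i : 'I_t => rej i).

Definition sigmaG x (t : nat) : set (set Omega) :=
  g_sigma_preimage (fun i : 'I_t => x i).

(* The union generating sigma(F^t, G^(t+1)), the information available when
   the level of the (t+1)-st test is chosen. *)
Definition history rej x (t : nat) : set (set Omega) :=
  sigmaF rej t `|` sigmaG x t.+1.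

(* In original (unshifted) time; +oo when there is no rejection. *)
Definition first_rejection rej (w : Omega) : \bar R :=
  ereal_inf [set i%:R%:E | i in [set i | rejections rej i w = 1%N]].

Fixpoint wealth (w0 : R) phi psi rej (t : nat) (w : Omega) : R :=
  if t is s.+1 then
    wealth w0 phi psi rej s w - phi s w + (rej s w)%:R * psi s w
  else w0.

Definition bonus (alpha w0 : R) rej (t : nat) (w : Omega) : R :=
  alpha - w0 * (t%:R%:E < first_rejection rej w)%E%:R.

(* a / b with a / 0 = +oo, including 0 / 0. *)
Definition quot (a b : R) : \bar R := if b == 0 then +oo%E else (a / b)%:E.

Record contextual_GAI (alpha : R) p x (w0 : R) lvl phi psi : Prop :=
    ContextualGAI {
  gai_lvl_measurable : forall t,
    measurable_wrt (history (decision p lvl) x t) (lvl t) ;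
  gai_phi_measurable : forall t,
    measurable_wrt (history (decision p lvl) x t) (phi t) ;
  gai_psi_measurable : forall t,
    measurable_wrt (history (decision p lvl) x t) (psi t) ;
  gai_lvl_ge0 : forall t w, 0 <= lvl t w ;
  gai_phi_ge0 : forall t w, 0 <= phi t w ;
  gai_psi_ge0 : forall t w, 0 <= psi t w ;
  gai_initial_wealth : 0 < w0 < alpha ;
  gai_wealth : forall t w,
    phi t w <= wealth w0 phi psi (decision p lvl) t w ;
  gai_reward : forall t w,
    let b := bonus alpha w0 (decision p lvl) t w in
    ((psi t w)%:E <= mine (phi t w + b)%:E
                          (quot (phi t w) (lvl t w) + (b - 1)%:E))%E }.

Definition cond_superuniform (Pr : probability Omega R) (H : nat -> bool)
    p x lvl : Prop :=
  forall t, H t = false ->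
    cond_prob_le Pr (history (decision p lvl) x t)
      [set w | p t w <= lvl t w] (lvl t).

Definition mFDR (Pr : probability Omega R) (H : nat -> bool) rej (T : nat) :
    \bar R :=
  ('E_Pr[fun w => (false_rejections H rej T w)%:R] /
   ('E_Pr[fun w => (rejections rej T w)%:R] + 1))%E.

End Testing.

(* Main.v *)
From mathcomp Require Import measurable_realfun ring lra.
Require Import Defs.

Set Implicit Arguments.
Unset Strict Implicit.
Unset Printing Implicit Defensive.

Import Order.TTheory GRing.Theory Num.Theory.
Import numFieldNormedType.Exports.
Import HBNNSimple.

Local Open Scope classical_set_scope.
Local Open Scope ring_scope.

(** Why the marginal FDR is controlled.  Write V and R for the numbers of false
and of all rejections after t steps and W for the wealth, and consider

   L = V + W - alpha R - w0 1{R = 0}.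

At time 0 it vanishes.  Because b is alpha, lowered by w0 until the first
rejection has occurred, every rejection increases alpha R + w0 1{R = 0} by
exactly b [bonusE], so a single test changes L by

   rej (1{null} + psi - b) - phi    [excessS].

At an alternative this is at most 0 pointwise, since psi <= phi + b.  At a null
the quantity 1 + psi - b is nonnegative, is known before the p-value is seen,
and satisfies (1 + psi - b) lvl <= phi [null_jump_lvl_le]; conditional
super-uniformity replaces rej by lvl in the expectation, so the expected
change is again at most 0 [null_jump_le].  Hence E L <= 0
[Rintegral_excess_le0].  As W >= 0 and w0 < alpha, this gives
E V <= alpha E R + w0 <= alpha (E R + 1).

The measure-theoretic content is the passage from Pr[A | G] <= f, which only
speaks of events of G, to E[h 1_A] <= E[h f] for nonnegative G-measurable h
[le_integral_weight, cond_prob_le_integral].  All expectations are finite: the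
wealth grows by at most alpha per step [wealth_le], which bounds phi and psi. *)

(** * Integrals against sub-sigma-algebras *)

Section sub_sigma_algebra_integrals.
Context {d : measure_display} {Omega : measurableType d} {R : realType}.

Lemma measurable_wrt_measurable (G : set (set Omega)) (f : Omega -> R) :
  <<s G >> `<=` measurable -> measurable_wrt G f -> measurable_fun setT f.
Proof.
by move=> subG mf mT B mB; apply: subG; exact: (mf measurableT _ mB).
Qed.

(** An inequality between the densities u and v that holds on average over
every event of G extends to weights f that are limits of G-measurable simple
functions, by linearity on the level sets and monotone convergence. *)
Lemma le_integral_weight (mu : {measure set Omega -> \bar R})
    (G : set (set Omega)) (u v f : Omega -> R) :
  <<s G >> `<=` measurable ->
  (forall w, 0 <= u w) -> measurable_fun setT u ->
  (forall w, 0 <= v w) -> measurable_fun setT v ->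
  (forall B, <<s G >> B ->
    \int[mu]_(w in B) (u w)%:E <= \int[mu]_(w in B) (v w)%:E)%E ->
  (forall w, 0 <= f w) -> measurable_wrt G f ->
  (\int[mu]_w (f w * u w)%:E <= \int[mu]_w (f w * v w)%:E)%E.
Proof.
move=> subG u0 mu_ v0 mv uv f0 mf.
have mTG : measurable [set: g_sigma_algebraType G] by exact: measurableT.
have mfE : measurable_fun [set: g_sigma_algebraType G]
    (EFin \o (f : g_sigma_algebraType G -> R)).
  exact/measurable_EFinP.
pose h := nnsfun_approx mTG mfE.
have mh n : measurable_fun [set: Omega] (h n : Omega -> R).
  by apply: (@measurable_wrt_measurable G) => //; exact: measurable_funP.
have h0 n (w : Omega) : 0 <= h n w by exact: fun_ge0.
(* A weighted integral is the limit of those with the simple weights h n. *)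
have step (g : Omega -> R) : (forall w, 0 <= g w) ->
    measurable_fun setT g ->
    (\int[mu]_w ((h n w * g w)%:E))%E @[n --> \oo] -->
      (\int[mu]_w ((f w * g w)%:E))%E.
  move=> g0 mg.
  have -> : (\int[mu]_w ((f w * g w)%:E) =
      \int[mu]_w (limn (fun n => (h n w * g w)%:E)))%E.
    apply: eq_integral => w _; apply/esym/cvg_lim => //.
    under eq_fun do rewrite EFinM.
    rewrite EFinM; apply: cvgeZr => //.
    by apply: (@cvg_nnsfun_approx _ _ _ _ mTG _ mfE) => // x _ /=;
       rewrite lee_fin.
  apply: cvg_monotone_convergence => //.
  - by move=> n; apply/measurable_EFinP; apply: measurable_funM.
  - by move=> n w _; rewrite lee_fin mulr_ge0.
  - move=> w _ a b ab; rewrite lee_fin ler_wpM2r//.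
    by have /lefP := nd_nnsfun_approx mTG mfE ab; exact.
have hlevel n y : <<s G >> (h n @^-1` [set y]).
  have mhG : measurable_fun [set: g_sigma_algebraType G] (h n).
    exact: measurable_funP.
  by rewrite -[X in <<s G >> X]setTI; exact: mhG mTG _ (measurable_set1 y).
have expand n (g : Omega -> R) : (forall w, 0 <= g w) ->
    measurable_fun setT g ->
    (\int[mu]_w ((h n w * g w)%:E) = \sum_(y \in range (h n))
       y%:E * \int[mu]_(w in h n @^-1` [set y]) (g w)%:E)%E.
  move=> g0 mg.
  have hy0 y (w : Omega) : 0 <= y * \1_(h n @^-1` [set y]) w.
    by rewrite -lee_fin EFinM; exact: nnfun_muleindic_ge0.
  have mi y : measurable_fun [set: Omega]
      (fun w => (\1_(h n @^-1` [set y]) w : R)).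
    by apply: measurable_indic; apply: subG.
  transitivity (\int[mu]_w \sum_(y \in range (h n))
      (y * \1_(h n @^-1` [set y]) w * g w)%:E)%E.
    apply: eq_integral => w _; rewrite fimfunE fsumEFin; last exact: fimfunP.
    by rewrite mulr_fsuml.
  rewrite ge0_integral_fsum//; last 2 first.
  - by move=> y; apply/measurable_EFinP; do 2! apply: measurable_funM => //.
  - by move=> y w _; rewrite lee_fin mulr_ge0.
  apply: eq_fsbigr => y; rewrite inE => -[w _ <-].
  under eq_integral do rewrite -mulrA EFinM.
  rewrite ge0_integralZl_EFin//; last 2 first.
  - by move=> x _; rewrite lee_fin mulr_ge0.
  - by apply/measurable_EFinP; apply: measurable_funM.
  congr (_ * _)%E; rewrite [RHS]integral_mkcond restrict_EFin.
  by apply: eq_integral => x _; rewrite patch_indic/= mulrC.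
apply: (@lee_cvg_to _ _ _ _ (fun n => \int[mu]_w (h n w * u w)%:E)%E
  (fun n => \int[mu]_w (h n w * v w)%:E)%E _ _ (step u u0 mu_) (step v v0 mv)).
apply: nearW => n; rewrite !expand//.
apply: lee_fsum => [|y [w _ <-]]; first exact: fimfunP.
by rewrite lee_wpmul2l ?lee_fin// uv.
Qed.

(** What conditional super-uniformity is used for: a bound f on the conditional
probability of A may replace the indicator of A under any integral with a
nonnegative weight that the conditioning sigma-algebra determines. *)
Lemma cond_prob_le_integral (Pr : probability Omega R) (G : set (set Omega))
    (A : set Omega) (f h : Omega -> R) :
  <<s G >> `<=` measurable -> measurable A ->
  (forall w, 0 <= f w) -> measurable_wrt G f ->
  (forall w, 0 <= h w) -> measurable_wrt G h ->
  cond_prob_le Pr G A f ->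
  (\int[Pr]_w (h w * \1_A w)%:E <= \int[Pr]_w (h w * f w)%:E)%E.
Proof.
move=> subG mA f0 mf h0 mh [Z [mZ iZ ZE] Zf].
have mfO := measurable_wrt_measurable subG mf.
have mA1 : measurable_fun [set: Omega] (\1_A : Omega -> R).
  exact: measurable_indic.
apply: (le_integral_weight (G := G)) => // B GB.
have mB := subG _ GB.
have -> : (\int[Pr]_(w in B) (\1_A w)%:E = \int[Pr]_(w in B) (Z w)%:E)%E.
  by rewrite ZE// integral_indic.
have iZB : Pr.-integrable B (EFin \o Z) by exact: integrableS iZ.
(* A version Z is only almost surely nonnegative; its positive part is still
   almost surely below f, and comparing integrals almost everywhere requires
   nonnegative integrands. *)
apply: (@le_trans _ _ (\int[Pr]_(w in B) ((EFin \o Z)^\+ w))%E).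
  apply: le_integral => //; first exact: integrable_funepos.
  by move=> w _; rewrite funeposE le_max lexx.
apply: ae_ge0_le_integral => //.
- exact: measurable_int (integrable_funepos mB iZB).
- by move=> w _; rewrite lee_fin.
- by apply/measurable_EFinP; exact: measurable_funS mfO.
- apply: filterS Zf => w Zfw _.
  by rewrite funeposE ge_max/= !lee_fin Zfw f0.
Qed.

Lemma bounded_integrable (mu : {finite_measure set Omega -> \bar R})
    (f : Omega -> R) M :
  measurable_fun setT f -> (forall w, `|f w| <= M) ->
  mu.-integrable setT (EFin \o f).
Proof.
move=> mf fM; apply: measurable_bounded_integrable => //.
  by rewrite -ge0_fin_numE//; exact: fin_num_measure.
exists M; split; first exact: num_real.
by move=> y My w _; exact: le_trans (fM w) (ltW My).
Qed.

End sub_sigma_algebra_integrals.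

(** * Counting rejections *)

Section rejection_counts.
Context {d : measure_display} {Omega : measurableType d}.
Implicit Types (rej : nat -> Omega -> bool).

Lemma rejectionsS rej t w :
  rejections rej t.+1 w = (rejections rej t w + rej t w)%N.
Proof. by rewrite /rejections big_ord_recr. Qed.

Lemma false_rejectionsS (H : nat -> bool) rej t w :
  false_rejections H rej t.+1 w =
  (false_rejections H rej t w + (~~ H t && rej t w))%N.
Proof.
rewrite /false_rejections 2!(big_mkcond (fun i => ~~ H _))/= big_ord_recr/=.
by case: (H t).
Qed.

Lemma leq_rejections rej s t w : (s <= t)%N ->
  (rejections rej s w <= rejections rej t w)%N.
Proof.
elim: t => [|t IH]; first by case: s.
rewrite leq_eqVlt => /predU1P[->//|/IH]; rewrite rejectionsS => /leq_trans->//.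
exact: leq_addr.
Qed.

(** The count of rejections moves by at most one per step, so as soon as it is
positive it has taken the value 1 at some earlier or present time. *)
Lemma first_rejection_gt (R : realType) rej t w :
  (t%:R%:E < first_rejection rej w :> \bar R)%E = (rejections rej t w == 0)%N.
Proof.
have [none|some] := eqVneq; last first.
  have [i it i1] : exists2 i, (i <= t)%N & rejections rej i w = 1%N.
    elim: t some => [|t IH]; first by rewrite /rejections big_ord0.
    have [none|some _] := eqVneq (rejections rej t w) 0%N; last first.
      by have [i it i1] := IH some; exists i => //; exact: leqW.
    rewrite rejectionsS none add0n => rt; exists t.+1 => //.
    by rewrite rejectionsS none; case: (rej t w) rt.
  apply/negbTE; rewrite -leNgt; apply: (@le_trans _ _ i%:R%:E).
    by apply: ereal_inf_lbound; exists i.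
  by rewrite lee_fin ler_nat.
apply: (@lt_le_trans _ _ t.+1%:R%:E); first by rewrite lte_fin ltr_nat.
apply: le_ereal_inf_tmp => _ [i /= i1 <-]; rewrite lee_fin ler_nat ltnNge.
by apply/negP => /(leq_rejections rej w); rewrite none i1.
Qed.

Lemma bonusE (R : realType) (alpha w0 : R) rej t w :
  bonus alpha w0 rej t w = alpha - w0 * (rejections rej t w == 0)%N%:R.
Proof. by rewrite /bonus first_rejection_gt. Qed.

End rejection_counts.

(** * Measurability with respect to the history *)

Section history_measurability.
Context {d dX : measure_display} {Omega : measurableType d}
  {X : measurableType dX} {R : realType}.

Lemma measurable_no_rejection d' (T : measurableType d')
    (rej : nat -> T -> bool) t :
  (forall i, (i < t)%N -> measurable_fun setT (rej i)) ->
  measurable_fun setT (fun w => rejections rej t w == 0)%N.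
Proof.
elim: t => [|t IH] mrej.
  rewrite /rejections; under eq_fun do rewrite big_ord0.
  exact: measurable_cst.
under eq_fun do rewrite rejectionsS addn_eq0 eqb0.
apply: measurable_and; last by apply: measurable_neg; exact: mrej.
by apply: IH => i it; apply: mrej; exact: ltnW.
Qed.

Lemma measurable_bool_natr d' (T : measurableType d') (f : T -> bool) :
  measurable_fun setT f -> measurable_fun setT (fun w => (f w)%:R : R).
Proof.
move=> mf; have -> : (fun w => (f w)%:R : R) = fun w => if f w then 1 else 0.
  by apply/funext => w; case: (f w).
exact: measurable_fun_ifT.
Qed.

Lemma g_sigma_preimage_sub d' (T : measurableType d') t
    (f : 'I_t -> Omega -> T) :
  (forall i, measurable_fun setT (f i)) -> g_sigma_preimage f `<=` measurable.
Proof.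
move=> mf; apply: smallest_sub; first exact: sigma_algebra_measurable.
apply: (big_ind (fun S : set (set Omega) => S `<=` measurable)).
- exact: sub0set.
- by move=> A B sA sB; rewrite subUset.
- by move=> i _ _ [B mB <-]; exact: mf.
Qed.

Lemma history_sub (rej : nat -> Omega -> bool) (x : nat -> Omega -> X) t :
  (forall i, (i < t)%N -> measurable_fun setT (rej i)) ->
  (forall i, measurable_fun setT (x i)) ->
  <<s history rej x t >> `<=` measurable.
Proof.
move=> mrej mx; apply: smallest_sub; first exact: sigma_algebra_measurable.
rewrite /history subUset; split; apply: g_sigma_preimage_sub => // i.
exact: mrej.
Qed.

Lemma measurable_history_rej (rej : nat -> Omega -> bool)
    (x : nat -> Omega -> X) t i : (i < t)%N ->
  measurable_fun [set: g_sigma_algebraType (history rej x t)]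
    (rej i : g_sigma_algebraType (history rej x t) -> bool).
Proof.
move=> it _ B mB; apply: sub_sigma_algebra; left; apply: sub_sigma_algebra.
by rewrite (bigD1 (Ordinal it))//=; left; exists B.
Qed.

(** Levels and decisions are intertwined: the level at time t is measurable only
because the history is made of measurable earlier decisions, whence the strong
induction. *)
Lemma measurable_decision (p lvl : nat -> Omega -> R) (x : nat -> Omega -> X) :
  (forall i, measurable_fun setT (p i)) ->
  (forall i, measurable_fun setT (x i)) ->
  (forall t, measurable_wrt (history (decision p lvl) x t) (lvl t)) ->
  forall t, measurable_fun setT (decision p lvl t).
Proof.
move=> mp mx mlvl; elim/ltn_ind => t IH; apply: measurable_fun_ler => //.
exact: measurable_wrt_measurable (history_sub IH mx) (mlvl t).
Qed.

End history_measurability.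

(** * The potential and its increments *)

Section potential.
Context {d : measure_display} {Omega : measurableType d} {R : realType}.
Variables (alpha w0 : R) (H : nat -> bool) (rej : nat -> Omega -> bool).
Variables (phi psi : nat -> Omega -> R).

(** The last term cancels the discount w0 that b carries until the first
rejection. *)
Definition excess t w : R :=
  (false_rejections H rej t w)%:R + wealth w0 phi psi rej t w
  - alpha * (rejections rej t w)%:R - w0 * (rejections rej t w == 0)%N%:R.

Definition increment t w : R :=
  (rej t w)%:R * ((~~ H t)%:R + psi t w - bonus alpha w0 rej t w) - phi t w.

Lemma excess0 w : excess 0 w = 0.
Proof.
by rewrite /excess /rejections /false_rejections !big_ord0/=; ring.
Qed.

(** A rejection adds b to alpha R + w0 1{R = 0}: alpha for the new rejection,
minus w0 when it is the first one. *)
Lemma excessS t w : excess t.+1 w = excess t w + increment t w.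
Proof.
rewrite /excess /increment bonusE rejectionsS false_rejectionsS !natrD/=.
rewrite addn_eq0 eqb0.
by case: (rej t w); case: (H t); case: (rejections rej t w == 0)%N => /=; ring.
Qed.

End potential.

(** * Expectation of the potential under a contextual GAI rule *)

Section contextual_GAI_theory.
Context {d dX : measure_display} {Omega : measurableType d}
  {X : measurableType dX} {R : realType}.
Variables (Pr : probability Omega R) (alpha w0 : R) (H : nat -> bool).
Variables (p : nat -> Omega -> R) (x : nat -> Omega -> X).
Variables (lvl phi psi : nat -> Omega -> R).
Hypothesis alpha_lt1 : alpha < 1.
Hypothesis mp : forall t, measurable_fun setT (p t).
Hypothesis mx : forall t, measurable_fun setT (x t).
Hypothesis gai : contextual_GAI alpha p x w0 lvl phi psi.
Hypothesis null : cond_superuniform Pr H p x lvl.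

Local Notation rej := (decision p lvl).
Local Notation W := (wealth w0 phi psi rej).
Local Notation b := (bonus alpha w0 rej).

Lemma w0_gt0 : 0 < w0. Proof. by case/andP: (gai_initial_wealth gai). Qed.

Lemma w0_lt : w0 < alpha. Proof. by case/andP: (gai_initial_wealth gai). Qed.

Lemma bonus_bounds t w : 0 <= b t w <= alpha.
Proof.
have := w0_gt0; have := w0_lt; rewrite bonusE.
by case: (_ == _) => /= ? ?; apply/andP; split; lra.
Qed.

Lemma psi_le t w : psi t w <= phi t w + b t w.
Proof. by have := gai_reward gai t w; rewrite /= le_min lee_fin => /andP[]. Qed.

(** The factor 1 + psi - b is what a false rejection adds to the potential
(before phi is paid); the second bound on the reward says that its mean, when
rejection has probability lvl, is covered by phi.  This includes lvl = 0, where
that bound is void. *)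
Lemma null_jump_lvl_le t w : (1 + psi t w - b t w) * lvl t w <= phi t w.
Proof.
have := gai_reward gai t w; rewrite /= le_min /quot => /andP[_].
have [->|lvl0] := eqVneq (lvl t w) 0.
  by move=> _; rewrite mulr0; exact: gai_phi_ge0 gai t w.
have lvl_gt0 : 0 < lvl t w by rewrite lt_def lvl0; exact: gai_lvl_ge0 gai t w.
rewrite -EFinD lee_fin => psile; rewrite -ler_pdivlMr//; lra.
Qed.

Lemma wealth_ge0 t w : 0 <= W t w.
Proof.
elim: t => [|t IH]/=; first exact: ltW w0_gt0.
rewrite addr_ge0 ?subr_ge0 ?(gai_wealth gai)// mulr_ge0//.
exact: gai_psi_ge0 gai t w.
Qed.

(** A rejection returns at most phi + alpha, so the wealth never gains more than
alpha in one step. *)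
Lemma wealth_le t w : W t w <= w0 + t%:R * alpha.
Proof.
elim: t => [|t IH]/=; first by rewrite mul0r addr0.
have := psi_le t w; have := bonus_bounds t w; have := gai_phi_ge0 gai t w.
by rewrite -natr1; case: (rej t w) => /= ? /andP[? ?] ?; lra.
Qed.

Lemma phi_le t w : phi t w <= w0 + t%:R * alpha.
Proof. exact: le_trans (gai_wealth gai t w) (wealth_le t w). Qed.

Let mrej t : measurable_fun setT (rej t).
Proof. exact: measurable_decision mp mx (gai_lvl_measurable gai) t. Qed.

Let subh t : <<s history rej x t >> `<=` measurable.
Proof. by apply: history_sub => // i _. Qed.

Let mrejR t : measurable_fun setT (fun w => (rej t w)%:R : R).
Proof. exact: measurable_bool_natr. Qed.

Let mphi t : measurable_fun setT (phi t).
Proof.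
exact: measurable_wrt_measurable (@subh t) (gai_phi_measurable gai (t:=t)).
Qed.

Lemma measurable_wrt_null_jump t :
  measurable_wrt (history rej x t) (fun w => 1 + psi t w - b t w).
Proof.
rewrite /measurable_wrt.
under eq_fun do rewrite bonusE.
apply: measurable_funB; first apply: measurable_funD.
- exact: measurable_cst.
- exact: (gai_psi_measurable gai (t:=t)).
- apply: measurable_funB; first exact: measurable_cst.
  apply: measurable_funM; first exact: measurable_cst.
  apply: measurable_bool_natr.
  apply: (@measurable_no_rejection _
    (g_sigma_algebraType (history rej x t)) rej).
  by move=> i; exact: measurable_history_rej.
Qed.

Let mjump t : measurable_fun setT (fun w => 1 + psi t w - b t w).
Proof.
exact: measurable_wrt_measurable (@subh t) (measurable_wrt_null_jump (t:=t)).
Qed.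

Lemma integrable_phi t : Pr.-integrable setT (EFin \o phi t).
Proof.
apply: (bounded_integrable Pr (M := w0 + t%:R * alpha)) => // w.
by rewrite ger0_norm ?phi_le//; exact: gai_phi_ge0 gai t w.
Qed.

Lemma null_jump_bounds t w :
  0 <= 1 + psi t w - b t w <= 1 + (w0 + t%:R * alpha).
Proof.
have := bonus_bounds t w; have := psi_le t w; have := phi_le t w.
have := gai_psi_ge0 gai t w; move=> ? ? ? /andP[? ?].
by apply/andP; split; have := alpha_lt1; lra.
Qed.

Lemma integrable_null_jump t :
  Pr.-integrable setT (fun w => ((rej t w)%:R * (1 + psi t w - b t w))%:E).
Proof.
apply: (bounded_integrable Pr (M := 1 + (w0 + t%:R * alpha))).
  exact: measurable_funM.
move=> w; have /andP[g0 g1] := null_jump_bounds t w.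
rewrite ger0_norm ?mulr_ge0//; case: (rej t w); rewrite ?mul1r ?mul0r//.
exact: le_trans g1.
Qed.

(** The one place where super-uniformity enters: it replaces the indicator of
rejection by the level, since the jump is known before the p-value is. *)
Lemma null_jump_le t : H t = false ->
  (\int[Pr]_w ((rej t w)%:R * (1 + psi t w - b t w)) <= \int[Pr]_w (phi t w)).
Proof.
move=> Ht; apply: fine_le.
- by apply: integrable_fin_num => //; exact: integrable_null_jump.
- by apply: integrable_fin_num => //; exact: integrable_phi.
pose A := [set w | p t w <= lvl t w].
have mA : measurable A.
  rewrite -[A]setTI; have -> : A = rej t @^-1` [set true] by [].
  exact: mrej.
have -> : (\int[Pr]_w ((rej t w)%:R * (1 + psi t w - b t w))%:E =
    \int[Pr]_w ((1 + psi t w - b t w) * \1_A w)%:E)%E.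
  apply: eq_integral => w _; rewrite mulrC indicE; congr (_ * _%:R)%:E.
  by congr nat_of_bool; apply/idP/idP; rewrite inE.
have g0 w : 0 <= 1 + psi t w - b t w by case/andP: (null_jump_bounds t w).
apply: (@le_trans _ _ (\int[Pr]_w ((1 + psi t w - b t w) * lvl t w)%:E)%E).
  apply: (cond_prob_le_integral (G := history rej x t)) => //.
  - exact: gai_lvl_ge0 gai t.
  - exact: (gai_lvl_measurable gai (t:=t)).
  - exact: measurable_wrt_null_jump.
  - exact: null.
apply: ge0_le_integral => //.
- by move=> w _; rewrite lee_fin mulr_ge0//; exact: gai_lvl_ge0 gai t w.
- apply/measurable_EFinP; apply: measurable_funM => //.
  exact: measurable_wrt_measurable (@subh t) (gai_lvl_measurable gai (t:=t)).
- exact/measurable_EFinP.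
- by move=> w _; rewrite lee_fin null_jump_lvl_le.
Qed.

Let integrable_rej t : Pr.-integrable setT (fun w => (rej t w)%:R%:E).
Proof.
apply: (bounded_integrable Pr (M := 1)) => // w.
by rewrite ger0_norm//; case: (rej t w).
Qed.

Lemma integrable_rejections t :
  Pr.-integrable setT (fun w => (rejections rej t w)%:R%:E).
Proof.
elim: t => [|t IH].
  by rewrite /rejections; under eq_fun do rewrite big_ord0; exact: integrable0.
under eq_fun do rewrite rejectionsS natrD EFinD.
exact: integrableD.
Qed.

Lemma integrable_false_rejections t :
  Pr.-integrable setT (fun w => (false_rejections H rej t w)%:R%:E).
Proof.
elim: t => [|t IH].
  rewrite /false_rejections; under eq_fun do rewrite big_ord0.
  exact: integrable0.
under eq_fun do rewrite false_rejectionsS natrD EFinD.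
apply: integrableD => //; case: (H t) => //=; exact: integrable0.
Qed.

Local Notation D := (increment alpha w0 H rej phi psi).
Local Notation L := (excess alpha w0 H rej phi psi).

(** Written this way the increment is a combination of terms already known to be
integrable, whether the hypothesis is null or not. *)
Lemma incrementE t w : D t w =
  (rej t w)%:R * (1 + psi t w - b t w) - phi t w - (H t)%:R * (rej t w)%:R.
Proof. by rewrite /increment; case: (H t) => /=; ring. Qed.

Lemma integrable_increment t : Pr.-integrable setT (fun w => (D t w)%:E).
Proof.
under eq_fun do rewrite incrementE 2!EFinB [((H t)%:R * _)%:E]EFinM.
apply: integrableB => //; last exact: integrableZl.
apply: integrableB => //; first exact: integrable_null_jump.
exact: integrable_phi.
Qed.

Lemma Rintegral_increment_le0 t : \int[Pr]_w (D t w) <= 0.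
Proof.
case Ht : (H t).
  rewrite -[leRHS](mul0r (fine (Pr setT))) -(Rintegral_cst Pr measurableT).
  apply: le_Rintegral => //; first exact: integrable_increment.
    exact: integrable0.
  move=> w _; rewrite /increment Ht add0r subr_le0.
  have := psi_le t w; have := gai_phi_ge0 gai t w.
  by case: (rej t w); rewrite ?mul0r ?mul1r// => *; lra.
under eq_Rintegral do rewrite incrementE Ht mul0r subr0.
rewrite RintegralB//; first by rewrite subr_le0 null_jump_le.
- exact: integrable_null_jump.
- exact: integrable_phi.
Qed.

Lemma Rintegral_excess_le0 t :
  Pr.-integrable setT (fun w => (L t w)%:E) /\ \int[Pr]_w (L t w) <= 0.
Proof.
elim: t => [|t [iL L0]].
  under eq_fun do rewrite excess0.
  split; first exact: integrable0.
  under eq_Rintegral do rewrite excess0.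
  by rewrite Rintegral_cst// mul0r.
have iD := integrable_increment t.
split; first by under eq_fun do rewrite excessS EFinD; exact: integrableD.
under eq_Rintegral do rewrite excessS.
by rewrite RintegralD// -[leRHS]addr0 lerD// Rintegral_increment_le0.
Qed.

(** Nonnegativity of the wealth is what turns the bound on the potential into a
bound on the false rejections. *)
Lemma false_rejections_le t w :
  (false_rejections H rej t w)%:R <=
  L t w + (alpha * (rejections rej t w)%:R + w0).
Proof.
have := wealth_ge0 t w; have := w0_gt0; rewrite /excess.
by case: (_ == 0)%N => /= *; lra.
Qed.

Lemma mFDR_le t : (mFDR Pr H rej t <= alpha%:E)%E.
Proof.
have iV := integrable_false_rejections t.
have iR := integrable_rejections t.
have [iL L0] := Rintegral_excess_le0 t.
have iaR : Pr.-integrable setT (fun w => (alpha * (rejections rej t w)%:R)%:E).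
  by under eq_fun do rewrite EFinM; exact: integrableZl.
have iw0 : Pr.-integrable setT (fun=> w0%:E).
  exact: finite_measure_integrable_cst.
have iaRw : Pr.-integrable setT
    (fun w => (alpha * (rejections rej t w)%:R + w0)%:E).
  by under eq_fun do rewrite EFinD; exact: integrableD.
rewrite /mFDR unlock.
have EV : (\int[Pr]_w (false_rejections H rej t w)%:R%:E =
    (\int[Pr]_w (false_rejections H rej t w)%:R)%:E)%E.
  by rewrite fineK//; exact: integrable_fin_num.
have ER : (\int[Pr]_w (rejections rej t w)%:R%:E =
    (\int[Pr]_w (rejections rej t w)%:R)%:E)%E.
  by rewrite fineK//; exact: integrable_fin_num.
rewrite EV ER -EFinD.
have R0 : 0 <= \int[Pr]_w ((rejections rej t w)%:R : R) by exact: Rintegral_ge0.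
have R1 : 0 < \int[Pr]_w ((rejections rej t w)%:R : R) + 1 by lra.
rewrite inver gt_eqF// lee_pdivrMr// -EFinM lee_fin.
have : \int[Pr]_w ((false_rejections H rej t w)%:R : R) <=
    \int[Pr]_w (L t w + (alpha * (rejections rej t w)%:R + w0)).
  apply: le_Rintegral => //; last by move=> w _; exact: false_rejections_le.
  by under [EFin \o _]funext do rewrite /= EFinD; exact: integrableD.
rewrite (@RintegralD _ _ _ _ _ (L t))//.
rewrite (@RintegralD _ _ _ _ _ (fun w => alpha * (rejections rej t w)%:R))//.
rewrite (@RintegralZl _ _ _ _ _ (fun w => (rejections rej t w)%:R))//.
rewrite Rintegral_cst//.
have -> : fine (Pr [set: Omega]) = 1 by rewrite probability_setT.
have := w0_lt; rewrite /=; lra.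
Qed.

End contextual_GAI_theory.

Theorem theorem2 (R : realType) (d : measure_display)
  (Omega : measurableType d) (Pr : probability Omega R)
  (alpha : R) (halpha : 0 < alpha < 1)
  (n : nat) (calX : set (n.-tuple R))
  (H : nat -> bool)
  (p : nat -> {RV Pr >-> R}) (x : nat -> {RV Pr >-> n.-tuple R})
  (hp : forall t w, 0 < p t w < 1)
  (hx : forall t w, calX (x t w))
  (w0 : R) (lvl phi psi : nat -> Omega -> R)
  (hGAI : contextual_GAI alpha p x w0 lvl phi psi)
  (hnull : cond_superuniform Pr H p x lvl) :
  (ereal_sup [set mFDR Pr H (decision p lvl) T | T in [set: nat]]
     <= alpha%:E)%E.
Proof.
have alpha_lt1 : alpha < 1 by case/andP: halpha.
apply: ge_ereal_sup => _ [T _ <-].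
by apply: (mFDR_le alpha_lt1 _ _ hGAI hnull) => t; exact: measurable_funP.
Qed.
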